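(* Let $N$ be the communication network with nodes $1,\dots,11$; directed edges $1\to4,\ 1\to6,\ 2\to4,\ 2\to5,\ 2\to6,\ 3\to5,\ 3\to6,\ 3\to11,\ 4\to7,\ 4\to8,\ 5\to8,\ 5\to9,\ 6\to7,\ 6\to9,\ 6\to10,\ 8\to10,\ 8\to11$; sender nodes $1,2,3$ with messages $x,y,z$ respectively; and receiver nodes $7,9,10,11$, where node $7$ requires $z$, node $9$ requires $x$, node $10$ requires $y$, and node $11$ requires $x$. Then $N$ has a linear solution over every ring $R$ with $1+1=0$, and $N$ has no linear solution over any Dedekind finite ring $R$ with $1+1\neq0$.
   Context: Rings are associative with $1$, not necessarily commutative. A ring $R$ is Dedekind finite if $\forall x,y\in R\ (xy=1\rightarrow yx=1)$. Messages are elements of a faithful left $R$-module $M$. A linear assignment over $R$ gives each edge $u\to v$ an element $r_{u,v}\in R$; each non-sender node $v$ carries the message $m_v=\sum_{u\to v} r_{u,v}m_u$. A linear solution over $R$ is an assignment for which every receiver node carries exactly its required message, for all choices of sender messages. Equivalently (since $M$ is faithful): for each sender $s$ and each receiver $t$, the sum over all directed paths $s=v_0\to v_1\to\dots\to v_l=t$ of the products $r_{v_{l-1},v_l}\cdots r_{v_1,v_2}r_{v_0,v_1}$ equals $1$ if $t$ requires the message of $s$, and equals $0$ otherwise. *)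

(* Defs.v *)
From HB Require Import structures.
From mathcomp Require Import all_boot all_order all_algebra.
Set Implicit Arguments.
Unset Strict Implicit.
Unset Printing Implicit Defensive.
Import GRing.Theory.
Local Open Scope ring_scope.

(* [pzRingType]: unital associative, not necessarily commutative; the zero
   ring is allowed. *)
Definition dedekind_finite (R : pzRingType) : Prop :=
  forall x y : R, x * y = 1 -> y * x = 1.

Definition faithful_module (R : pzRingType) (M : lmodType R) : Prop :=
  forall a : R, (forall x : M, a *: x = 0) -> a = 0.

(* [demand t = Some s] means that [t] is a receiver requiring the message of
   the sender [s]; [None] means that [t] is not a receiver. *)
Record network := Network {
  node : finType;
  edge : rel node;
  sender : pred node;
  demand : node -> option node;
  demand_sender : forall t s, demand t = Some s -> sender s;
  edge_acyclic : forall u v, edge u v -> ~~ connect edge v u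
}.

Section LinearSolution.
Variables (N : network) (R : pzRingType) (M : lmodType R).

(* [r u v] is the coefficient on the edge [u -> v]; its value is irrelevant
   when [u -> v] is not an edge. *)
Definition assignment := node N -> node N -> R.

(* [m] is the family of messages carried by the nodes when each sender [s]
   emits [m s]. As the network is acyclic, each choice of sender messages
   extends to exactly one such family. *)
Definition carried (r : assignment) (m : node N -> M) : Prop :=
  forall v, ~~ sender v -> m v = \sum_(u | edge u v) r u v *: m u.

Definition linear_solution (r : assignment) : Prop :=
  forall m, carried r m -> forall t s, demand t = Some s -> m t = m s.

Definition has_linear_solution : Prop := exists r, linear_solution r.

End LinearSolution.

(* The nodes 1, ..., 11 are represented by ['I_11], whose element of value [i]
   stands for the node [i.+1]; edges, senders and demands below are given in
   terms of the labels 1, ..., 11. *)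
Definition net_label (v : 'I_11) : nat := v.+1.
Definition net_node (k : nat) : 'I_11 := inord k.-1.

Definition net_edges : seq (nat * nat) :=
  [:: (1, 4); (1, 6); (2, 4); (2, 5); (2, 6); (3, 5); (3, 6); (3, 11);
      (4, 7); (4, 8); (5, 8); (5, 9); (6, 7); (6, 9); (6, 10);
      (8, 10); (8, 11)]%N.

Definition net_edge : rel 'I_11 :=
  fun u v => (net_label u, net_label v) \in net_edges.

Definition net_sender : pred 'I_11 :=
  fun v => net_label v \in [:: 1; 2; 3]%N.

Definition net_demand (t : 'I_11) : option 'I_11 :=
  match net_label t with
  | 7 => Some (net_node 3)
  | 9 => Some (net_node 1)
  | 10 => Some (net_node 2)
  | 11 => Some (net_node 1)
  | _ => None
  end.

Fact net_demand_sender t s : net_demand t = Some s -> net_sender s.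
Proof.
rewrite /net_demand; case: t.
do 11![case=> [|] /=; first by move=> _ // [<-];
  rewrite /net_sender /net_label /net_node inordK].
by [].
Qed.

Fact net_edge_lt u v : net_edge u v -> (u < v)%N.
Proof.
have /allP lt_edges : all (fun p => p.1 < p.2)%N net_edges by [].
by move/lt_edges.
Qed.

Fact net_edge_acyclic u v : net_edge u v -> ~~ connect net_edge v u.
Proof.
move/net_edge_lt=> lt_uv; apply/negP=> /connectP[p].
elim: p v lt_uv => [|w p IHp] v lt_uv /=; first by move=> _ eq_uv; rewrite eq_uv ltnn in lt_uv.
by move=> /andP[/net_edge_lt lt_vw]; apply: IHp; apply: ltn_trans lt_vw.
Qed.

Definition networkN : network :=
  Network net_demand_sender net_edge_acyclic.

(* Main.v *)
Require Import Defs.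
From HB Require Import structures.
From mathcomp Require Import all_boot all_order all_algebra.
Set Implicit Arguments.
Unset Strict Implicit.
Unset Printing Implicit Defensive.
Import GRing.Theory.
Local Open Scope ring_scope.

(** Sending one message at a time turns a linear solution into equations between
    the edge coefficients. Let [A] and [B] be the composite coefficients of
    [1 -> 4 -> 8] and [3 -> 5 -> 8], and let [e], [g], [n] be those of [1 -> 6],
    [3 -> 6], [6 -> 9]. By Dedekind finiteness [n] is a two-sided inverse of [e],
    and the demand of 10 for [y] makes the coefficient of [2 -> 6] invertible,
    because 11 must not receive [y]. Cancelling [x] and [y] at 7, 9 and 11 then
    gives [B = - A n g], whereas cancelling [x] and [z] at 10 gives [B = A n g];
    as all these are units, [1 + 1 = 0]. Conversely, if [1 + 1 = 0] then all
    coefficients can be taken equal to 1. *)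

Lemma net_labelK : cancel net_label net_node.
Proof. by move=> v; rewrite /net_node inord_val. Qed.

Lemma net_nodeK k : (0 < k <= 11)%N -> net_label (net_node k) = k.
Proof. by case: k => // k lek; rewrite /net_label inordK. Qed.

(** [net_edges] is duplicate-free with tails in range, so its filtered tails enumerate the
    predecessors of [v] once each. The list sum, unlike the one over ['I_11], unfolds by
    computation. *)
Lemma sum_net_edge (V : nmodType) (F : 'I_11 -> V) (v : 'I_11) :
  \sum_(u | net_edge u v) F u =
  \sum_(e <- net_edges | e.2 == net_label v) F (net_node e.1).
Proof.
have tailK e : e \in net_edges -> net_label (net_node e.1) = e.1.
  have /allP le_edges : all (fun e => 0 < e.1 <= 11)%N net_edges by [].
  by move/le_edges=> /net_nodeK.
rewrite -big_filter -[RHS]big_filter.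
rewrite -[RHS](big_map (fun e => net_node e.1) xpredT F).
apply/perm_big/uniq_perm=> [||u].
- exact/filter_uniq/index_enum_uniq.
- rewrite map_inj_in_uniq ?filter_uniq // => -[j k] [j' k'].
  rewrite !mem_filter /= => /andP[/eqP-> /tailK jK] /andP[/eqP-> /tailK jK'].
  by move/(congr1 net_label); rewrite jK jK' /= => ->.
rewrite mem_filter mem_index_enum andbT; apply/idP/mapP=> [uv | [[j k]]].
  by exists (net_label u, net_label v); rewrite ?mem_filter ?eqxx //= net_labelK.
rewrite mem_filter /= => /andP[/eqP-> jv ->].
by rewrite /net_edge (tailK _ jv).
Qed.

Definition edge_coef (R : pzRingType) (r : assignment networkN R) (j k : nat) :=
  r (net_node j) (net_node k).

Lemma carried_networkN (R : pzRingType) (M : lmodType R)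
    (r : assignment networkN R) (m : node networkN -> M) :
  let c := edge_coef r in
  carried r m <->
  [/\ m (net_node 4) = c 1%N 4%N *: m (net_node 1) + c 2%N 4%N *: m (net_node 2),
      m (net_node 5) = c 2%N 5%N *: m (net_node 2) + c 3%N 5%N *: m (net_node 3),
      m (net_node 6) = c 1%N 6%N *: m (net_node 1) +
        (c 2%N 6%N *: m (net_node 2) + c 3%N 6%N *: m (net_node 3)) &
  [/\ m (net_node 7) = c 4%N 7%N *: m (net_node 4) + c 6%N 7%N *: m (net_node 6),
      m (net_node 8) = c 4%N 8%N *: m (net_node 4) + c 5%N 8%N *: m (net_node 5),
      m (net_node 9) = c 5%N 9%N *: m (net_node 5) + c 6%N 9%N *: m (net_node 6),
      m (net_node 10) =
        c 6%N 10%N *: m (net_node 6) + c 8%N 10%N *: m (net_node 8) &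
      m (net_node 11) =
        c 3%N 11%N *: m (net_node 3) + c 8%N 11%N *: m (net_node 8)]].
Proof.
move=> c.
have sumE k : (0 < k <= 11)%N ->
    \sum_(u | net_edge u (net_node k)) r u (net_node k) *: m u =
    \sum_(e <- net_edges | e.2 == k) c e.1 k *: m (net_node e.1).
  by move=> lek; rewrite sum_net_edge net_nodeK.
split=> [C | [E4 E5 E6 [E7 E8 E9 E10 E11]] v].
  have Ck k : (3 < k <= 11)%N ->
      m (net_node k) =
      \sum_(e <- net_edges | e.2 == k) c e.1 k *: m (net_node e.1).
    case/andP=> lt3k lek; have k_gt0 : (0 < k <= 11)%N by case: k lt3k lek.
    rewrite -sumE //; apply: C; rewrite /= /net_sender net_nodeK //.
    by case: k lt3k {lek k_gt0} => [|[|[|[|]]]].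
  by split; [| | |split]; rewrite Ck // unlock /= !addr0.
rewrite -[v]net_labelK; have: (0 < net_label v <= 11)%N by rewrite /= ltn_ord.
move: (net_label v) => k lek; rewrite /= sumE // /net_sender net_nodeK //.
(* Label 0 is out of range and 1, 2, 3 are senders, which leaves 4 to 11. *)
case: k lek => [|[|[|[|k]]]]; [discriminate.. |].
rewrite unlock; do 8![case: k => [_ _ | k]; first by rewrite /= !addr0].
discriminate.
Qed.

(** The composites [A] and [B] above are [j * a] and [k * d]; [f] belongs to the edge [2 -> 6]. *)
Lemma net_equations_char2 (R : pzRingType)
    (a b c d e f g h i j k l n p q t : R) :
  dedekind_finite R ->
  h * a + i * e = 0 -> h * b + i * f = 0 -> i * g = 1 ->
  n * e = 1 -> l * c + n * f = 0 -> l * d + n * g = 0 ->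
  p * e + q * (j * a) = 0 -> p * f + q * (j * b + k * c) = 1 ->
    p * g + q * (k * d) = 0 ->
  t * (j * a) = 1 -> t * (j * b + k * c) = 0 ->
  1 + 1 = 0 :> R.
Proof.
move=> dfR E7x E7y ig ne E9y E9z E10x E10y E10z tja E11y.
have gi := dfR _ _ ig; have en := dfR _ _ ne; have jat := dfR _ _ tja.
(* [jat] cancels [t]: no [y] reaches node 8, so node 10 gets its [y] directly from node 6. *)
have jb_kc : j * b + k * c = 0 by rewrite -[LHS]mul1r -jat -mulrA E11y mulr0.
have fp : f * p = 1 by apply: dfR; rewrite -E10y jb_kc mulr0 addr0.
have atj : a * (t * j) = 1 by apply: dfR; rewrite -mulrA.
have oppP (x y : R) : x + y = 0 -> x = - y.
  by move/eqP; rewrite addr_eq0 => /eqP.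
(* By [atj] and [E7x], [h = - (i * e * (t * j))]; this eliminates [h] from [E7y]. *)
have ifE : i * f = i * e * (t * j) * b.
  rewrite (oppP (i * f) (h * b)) 1?addrC // -[h]mulr1 -atj (mulrA h a).
  by rewrite (oppP _ _ E7x) !mulNr opprK.
have tjb : t * j * b = n * f.
  rewrite -[f]mul1r -gi -[g * i * f]mulrA ifE !mulrA.
  by rewrite -(mulrA n g i) gi mulr1 ne mul1r.
have bE : b = a * n * f by rewrite -mulrA -tjb mulrA atj mul1r.
(* A left inverse of [d]; Dedekind finiteness makes it two-sided, so that [E9y] can be solved for
   [c]. *)
have ld : - (i * e * l) * d = 1.
  rewrite mulNr -mulrA (oppP _ _ E9z) mulrN opprK !mulrA.
  by rewrite -(mulrA i e n) en mulr1.
have cE : c = d * i * f.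
  rewrite -[LHS]mul1r -(dfR _ _ ld) mulrN mulNr -!mulrA (oppP _ _ E9y).
  by rewrite !mulrN opprK (mulrA e n) en mul1r.
(* By [cE], [c * p * g = d]; hence the cancellation of [y] at node 8 determines [k * d]. *)
have kdE : k * d = - (j * a * n * g).
  have ->: k * d = k * c * p * g.
    by rewrite cE !mulrA -(mulrA _ f p) fp mulr1 -(mulrA _ i g) ig mulr1.
  rewrite (oppP (k * c) (j * b)) 1?addrC // bE !mulNr !mulrA.
  by rewrite -(mulrA _ f p) fp mulr1.
have pE : p = - (q * (j * a) * n).
  by rewrite -[LHS]mulr1 -en mulrA (oppP _ _ E10x) mulNr.
have Q2 : q * (j * a) * n * g + q * (j * a) * n * g = 0.
  apply: oppr_inj; rewrite oppr0 -[RHS]E10z kdE pE.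
  by rewrite opprD mulNr mulrN !mulrA.
(* Flanking the element doubled in [Q2] by [f] and [i], the inverses of [p] and [g], turns [Q2] into
   [- (1 + 1) = 0]. *)
have fQ : f * (q * (j * a) * n * g) * i = - 1.
  by rewrite -[q * _ * n]opprK -pE mulNr mulrN mulNr mulrA fp mul1r gi.
by apply: oppr_inj; rewrite opprD oppr0 -fQ -mulrDl -mulrDr Q2 mulr0 mul0r.
Qed.

Lemma faithful_scaleI (R : pzRingType) (M : lmodType R) (a b : R) :
  faithful_module M -> (forall x : M, a *: x = b *: x) -> a = b.
Proof.
by move=> fM ab; apply/subr0_eq/fM => x; rewrite scalerBl ab subrr.
Qed.

Theorem mainTheorem3 (R : pzRingType) (M : lmodType R)
    (M_faithful : faithful_module M) :
  (1 + 1 = 0 :> R -> has_linear_solution networkN M) /\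
  (dedekind_finite R -> 1 + 1 <> 0 :> R -> ~ has_linear_solution networkN M).
Proof.
split=> [R2 | dfR R2 [r solr]].
  have M2 (v : M) : v + v = 0 by rewrite -[v]scale1r -scalerDl R2 scale0r.
  have addKl (u v : M) : u + (u + v) = v by rewrite addrA M2 add0r.
  have addKr (u v : M) : u + (v + u) = v by rewrite addrCA M2 addr0.
  exists (fun _ _ => 1) => m /carried_networkN; rewrite !scale1r.
  case=> E4 E5 E6 [E7 E8 E9 E10 E11] t s; rewrite -[t]net_labelK /= /net_demand.
  have := ltn_ord t; rewrite net_labelK -[X in _ -> _ -> m X = _]net_labelK.
  (* Two copies of the message of node 2 reach node 8, through 4 and 5, and cancel. *)
  have {}E8 : m (net_node 8) = m (net_node 1) + m (net_node 3).
    by rewrite E8 E4 E5 -addrA addKl.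
  case: (net_label t) => [|[|[|[|[|[|[|[|[|[|[|[|?]]]]]]]]]]]] // _ [<-].
  - by rewrite E7 E4 E6 [X in _ + X]addrA addKl.
  - by rewrite E9 E5 E6 addKr.
  - by rewrite E10 E6 E8 [X in X + _]addrCA -addrA M2 addr0.
  - by rewrite E11 E8 addKr.
have sol (x y z : M) :
    let c := edge_coef r in
    let m4 := c 1%N 4%N *: x + c 2%N 4%N *: y in
    let m5 := c 2%N 5%N *: y + c 3%N 5%N *: z in
    let m6 := c 1%N 6%N *: x + (c 2%N 6%N *: y + c 3%N 6%N *: z) in
    let m8 := c 4%N 8%N *: m4 + c 5%N 8%N *: m5 in
    [/\ c 4%N 7%N *: m4 + c 6%N 7%N *: m6 = z,
        c 5%N 9%N *: m5 + c 6%N 9%N *: m6 = x,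
        c 6%N 10%N *: m6 + c 8%N 10%N *: m8 = y &
        c 3%N 11%N *: z + c 8%N 11%N *: m8 = x].
  move=> c m4 m5 m6 m8.
  (* The carried family generated by [x], [y], [z]: index [k] of [s] holds the message of label
     [k.+1]. *)
  pose s := [:: x; y; z; m4; m5; m6; c 4%N 7%N *: m4 + c 6%N 7%N *: m6; m8;
    c 5%N 9%N *: m5 + c 6%N 9%N *: m6; c 6%N 10%N *: m6 + c 8%N 10%N *: m8;
    c 3%N 11%N *: z + c 8%N 11%N *: m8].
  pose m (v : node networkN) := nth 0 s v.
  have mE k : (k < 11)%N -> m (net_node k.+1) = nth 0 s k.
    by move=> ltk; rewrite /m /net_node inordK.
  have mC : carried r m by apply/carried_networkN; rewrite !mE.
  have D t s' : net_demand (net_node t) = Some s' -> m (net_node t) = m s'.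
    exact: solr.
  split; [have := D 7%N (net_node 3) | have := D 9%N (net_node 1)
         | have := D 10%N (net_node 2) | have := D 11%N (net_node 1)];
    by rewrite /net_demand net_nodeK // !mE //; apply.
apply/R2/(net_equations_char2 (a := edge_coef r 1 4) (b := edge_coef r 2 4)
  (c := edge_coef r 2 5) (d := edge_coef r 3 5) (e := edge_coef r 1 6)
  (f := edge_coef r 2 6) (g := edge_coef r 3 6) (h := edge_coef r 4 7)
  (i := edge_coef r 6 7) (j := edge_coef r 4 8) (k := edge_coef r 5 8)
  (l := edge_coef r 5 9) (n := edge_coef r 6 9) (p := edge_coef r 6 10)
  (q := edge_coef r 8 10) (t := edge_coef r 8 11) dfR);
(* Letting one sender emit [u] and the others 0 isolates one coefficient at one receiver. *)
apply: (faithful_scaleI M_faithful) => u;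
[ have [+ _ _ _] := sol u 0 0 | have [+ _ _ _] := sol 0 u 0
| have [+ _ _ _] := sol 0 0 u | have [_ + _ _] := sol u 0 0
| have [_ + _ _] := sol 0 u 0 | have [_ + _ _] := sol 0 0 u
| have [_ _ + _] := sol u 0 0 | have [_ _ + _] := sol 0 u 0
| have [_ _ + _] := sol 0 0 u | have [_ _ _ +] := sol u 0 0
| have [_ _ _ +] := sol 0 u 0 ];
rewrite ?(scaler0, addr0, add0r) ?scale0r ?scale1r;
rewrite ?(mulrDr, scalerDl) -?scalerA ?scalerDr; exact.
Qed.
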